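(* Let $X$ be a real Hilbert space and let $U,V,W$ be closed linear subspaces of $X$. Then $$\operatorname{Fix}(R_WR_VR_U)=\operatorname{Fix}\big(4P_WP_VP_U-2(P_WP_V+P_WP_U+P_VP_U)+P_W+P_V+P_U\big)$$ and $$\operatorname{Fix}(R_WR_VR_U)\subseteq U+V+W.$$
   Context: For a closed linear subspace $U$ of $X$, $P_U$ denotes the orthogonal projector onto $U$, and $R_U:=2P_U-\operatorname{Id}$ is the corresponding reflector. For a map $T\colon X\to X$, $\operatorname{Fix} T=\{x\in X : Tx=x\}$. Juxtaposition of operators denotes composition. $U+V+W=\{u+v+w : u\in U, v\in V, w\in W\}$ (the algebraic sum, no closure taken). *)

(* Defs.v *)
From HB Require Import structures.
From mathcomp Require Import all_boot all_order all_algebra.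
From mathcomp Require Import all_classical all_reals all_analysis.
Set Implicit Arguments.
Unset Strict Implicit.
Unset Printing Implicit Defensive.
Import Order.TTheory GRing.Theory Num.Theory.
Import numFieldNormedType.Exports.
Local Open Scope classical_set_scope.
Local Open Scope ring_scope.

(* A real Hilbert space is a complete normed module X over a realType R,
   together with an inner product (a symmetric positive definite bilinear
   form, {dot X for idfun}) that induces the norm of X. *)
Definition inner_product_norm (R : realType) (X : completeNormedModType R)
    (dot : {dot X for idfun}) : Prop :=
  forall x : X, `|x| ^+ 2 = dot x x.

Definition closed_linear_subspace (R : realType) (X : completeNormedModType R)
    (U : set X) : Prop :=
  GRing.submod_closed [in U] /\ closed U.

(* P_U x is the point p of U such that x - p is orthogonal to U. It exists and
   is unique for every x when U is a closed linear subspace of a Hilbert space;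
   the default value 0 is only used when there is no such p. *)
Definition orth_proj (R : realType) (X : completeNormedModType R)
    (dot : {dot X for idfun}) (U : set X) : X -> X :=
  fun x => xget 0 [set p | U p /\ forall u, U u -> dot (x - p) u = 0].

Definition orth_reflector (R : realType) (X : completeNormedModType R)
    (dot : {dot X for idfun}) (U : set X) : X -> X :=
  2 *: orth_proj dot U - idfun.

Definition fixed_points (X : Type) (T : X -> X) : set X := [set x | T x = x].

Definition set_add (X : zmodType) (A B : set X) : set X :=
  [set a + b | a in A & b in B].

(* Main.v *)
Require Import Defs.
From mathcomp Require Import all_boot all_order all_algebra.
From mathcomp Require Import all_classical all_reals all_analysis.
From mathcomp Require Import ring lra.
Import Order.TTheory GRing.Theory Num.Theory.
Import numFieldNormedType.Exports.
Local Open Scope classical_set_scope.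
Local Open Scope ring_scope.

Set Implicit Arguments.
Unset Strict Implicit.

(** With [R_S = 2 P_S - Id], put [v = R_U x] and [w = R_V v].  Then [v = 2 P_U x - x],
    [w = 2 P_V v - v] and [R_W w = 2 P_W w - w] telescope to
      [R_W R_V R_U x = 2 (P_U x - P_V v + P_W w) - x]   ([reflector3E]),
    so [x] is fixed by the product of reflectors exactly when
      [x = P_U x - P_V v + P_W w]   ([reflector3_fixedP]).
    The right-hand side visibly lies in [U + V + W], which is the inclusion.

    The equality of the two fixed-point sets follows because the same
    right-hand side, once [v] and [w] are expanded, is the value at [x] of the
    polynomial in the projectors ([reflector3_projE]).  This expansion
    uses the linearity of [P_V] and [P_W], and linearity is where the Hilbert
    space structure enters: it is immediate from the
    characterisation of [P_S x] as the point of [S] with [x - P_S x] orthogonal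
    to [S] ([orth_proj_linear]), as soon as such a point is known to exist for
    every [x].  Existence is the projection theorem: by the parallelogram law
    the near-minimizers of the distance from [x] to [S] form a Cauchy filter
    ([near_minimizers_close]); its limit is a minimizer ([minimizer_exists]),
    and a first-variation argument shows that a minimizer is an orthogonal
    projection ([minimizer_orthogonal]). *)

(** * Linear subspaces as sets *)

Lemma subspace_zero_lin (R : pzRingType) (X : lmodType R) (U : set X) :
  GRing.submod_closed [in U] ->
  U 0 /\ forall a u v, U u -> U v -> U (a *: u + v).
Proof.
case=> /set_mem U0 Ulin; split=> // a u v Uu Uv.
by apply: set_mem; apply: Ulin; exact: mem_set.
Qed.

Lemma subspace0 (R : pzRingType) (X : lmodType R) (U : set X) :
  GRing.submod_closed [in U] -> U 0.
Proof. by case/subspace_zero_lin. Qed.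

Lemma subspaceN (R : pzRingType) (X : lmodType R) (U : set X) u :
  GRing.submod_closed [in U] -> U u -> U (- u).
Proof.
case/subspace_zero_lin => U0 Ulin Uu.
by rewrite -scaleN1r -[_ *: _]addr0; exact: Ulin.
Qed.

Lemma subspaceB (R : pzRingType) (X : lmodType R) (U : set X) u v :
  GRing.submod_closed [in U] -> U u -> U v -> U (u - v).
Proof.
move=> subU Uu Uv; have [_ Ulin] := subspace_zero_lin subU.
by rewrite -[u]scale1r; apply: Ulin => //; exact: subspaceN.
Qed.

(** * Orthogonal projections onto closed subspaces *)

Section InnerProduct.
Context (R : realType) (X : completeNormedModType R) (dot : {dot X for idfun}).

Lemma dot_definite x : dot x x = 0 -> x = 0.
Proof.
move=> dx0; apply/eqP; apply: contraT => x0.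
have : 0 < dot x x by exact: neq0_dnorm_gt0.
by rewrite dx0 ltxx.
Qed.

Hypothesis hdot : inner_product_norm dot.

Lemma sqr_normB (x y : X) : `|x - y| ^+ 2 = `|x| ^+ 2 - 2 * dot x y + `|y| ^+ 2.
Proof. by rewrite !hdot hnormB /= expr0 mul1r; ring. Qed.

Lemma parallelogram (x y : X) :
  `|x + y| ^+ 2 + `|x - y| ^+ 2 = 2 * (`|x| ^+ 2 + `|y| ^+ 2).
Proof. by rewrite -{1}[y]opprK !sqr_normB normrN linearNr; ring. Qed.

(** The midpoint of [u] and [v] is again in [U], so its distance to [x] is at
    least [d]; the parallelogram law for [x - u] and [x - v] then leaves little
    room for [u - v]. *)
Lemma near_minimizers_close (U : set X) (x : X) d e u v :
  GRing.submod_closed [in U] -> (forall w, U w -> d <= `|x - w| ^+ 2) ->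
  U u -> U v -> `|x - u| ^+ 2 < d + e -> `|x - v| ^+ 2 < d + e ->
  `|u - v| ^+ 2 < 4 * e.
Proof.
move=> subU dmin Uu Uv du dv.
have [U0 Ulin] := subspace_zero_lin subU.
have Um : U (2^-1 *: u + 2^-1 *: v).
  by apply: (Ulin) => //; rewrite -[_ *: v]addr0; exact: Ulin.
have := dmin _ Um; have := parallelogram (x - u) (x - v).
have -> : x - u + (x - v) = 2 *: (x - (2^-1 *: u + 2^-1 *: v)).
  rewrite scalerBr scalerDr !scalerA divff// !scale1r scaler_nat mulr2n.
  by rewrite opprD addrACA.
have -> : x - u - (x - v) = - (u - v).
  by rewrite !opprB addrC addrA subrK.
by rewrite normrN normrZ exprMn ger0_norm//; lra.
Qed.

(** Existence half of the projection theorem.  A filter of near-minimizers takes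
    the place of a minimizing sequence, which avoids choosing its terms. *)
Lemma minimizer_exists (U : set X) (x : X) :
  closed_linear_subspace U ->
  exists2 p, U p & forall u, U u -> `|x - p| ^+ 2 <= `|x - u| ^+ 2.
Proof.
case=> subU clU.
pose D := [set `|x - u| ^+ 2 | u in U].
have D0 : lbound D 0 by move=> _ [u _ <-]; rewrite sqr_ge0.
have hinfD : has_inf D.
  split; last by exists 0.
  by exists (`|x - 0| ^+ 2); exists 0 => //; exact: subspace0.
have dmin w : U w -> inf D <= `|x - w| ^+ 2.
  by move=> Uw; apply: ge_inf; [case: hinfD | exists w].
pose B e := [set u | U u /\ `|x - u| ^+ 2 < inf D + e].
pose F := filter_from [set e : R | 0 < e] B.
have FB e : 0 < e -> F (B e) by move=> e0; exists e.
have FF : ProperFilter F.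
  apply: filter_from_proper; first apply: filter_from_filter.
  - by exists 1 => /=.
  - move=> i j /= i0 j0; exists (Num.min i j); first by rewrite /= lt_min i0.
    by move=> u [Uu]; rewrite addr_minr lt_min => /andP[].
  - move=> e /= e0; have [_ [u Uu <-] ue] := inf_adherent e0 hinfD.
    by exists u.
have /cauchy_cvg/cvg_ex[p Fp] : cauchy F.
  apply: cauchy_exP => e e0.
  (* two points of [B (e ^+ 2 / 4)] are at distance less than [e] *)
  have e40 : 0 < e ^+ 2 / 4 by rewrite divr_gt0 ?exprn_gt0.
  have [u [Uu du]] : B (e ^+ 2 / 4) !=set0 by exact: filter_ex (FB _ e40).
  exists u; apply: filterS (FB _ e40) => v [Uv dv].
  rewrite -ball_normE /ball_ /= -(@ltr_pXn2r _ 2) ?nnegrE ?(ltW e0)//.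
  have := near_minimizers_close subU dmin Uu Uv du dv.
  by rewrite mulrCA divff// mulr1.
have Up : U p.
  apply: (@closed_cvg _ _ F FF id) => //.
  by apply: filterS (FB 1 ltr01) => u [].
exists p => // u Uu; apply: le_trans (dmin _ Uu).
apply/ler_addgt0Pr => e e0.
have cv : `|x - y| ^+ 2 @[y --> F] --> `|x - p| ^+ 2.
  have : `|x - y| @[y --> F] --> `|x - p|.
    by apply: cvg_norm; apply: cvgB => //; exact: cvg_cst.
  by move=> c; rewrite expr2; under eq_fun do rewrite expr2; exact: cvgM.
apply: (cvgr_to_le cv).
by apply: filterS (FB _ e0) => y [_ /ltW].
Qed.

(** Moving from [p] by [t *: u] changes the squared distance to [x] by
    [t ^ 2 |u| ^ 2 - 2 t c] with [c = dot (x - p) u], which would be negative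
    for a small [t] of the sign of [c] if [c] were nonzero. *)
Lemma minimizer_orthogonal (U : set X) (x : X) p :
  GRing.submod_closed [in U] -> U p ->
  (forall u, U u -> `|x - p| ^+ 2 <= `|x - u| ^+ 2) ->
  forall u, U u -> dot (x - p) u = 0.
Proof.
move=> subU Up pmin u Uu.
have [_ Ulin] := subspace_zero_lin subU.
set c := dot (x - p) u; set n := `|u| ^+ 2.
have n0 : 0 <= n by rewrite sqr_ge0.
have n1 : n + 1 != 0 by rewrite gt_eqF// ltr_wpDl.
(* The optimal step is [c / n]; adding 1 to [n] keeps the denominator positive
   when [u = 0] and the variation still has the sign of [- c ^ 2]. *)
have := pmin _ (Ulin (c / (n + 1)) u p Uu Up).
rewrite opprD [- _ - p]addrC addrA [leRHS]sqr_normB linearZr_LR /= -/c.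
rewrite normrZ exprMn -/n real_normK ?num_real// => le1.
have : 0 <= - (c / (n + 1)) ^+ 2 * (n + 2).
  have -> : - (c / (n + 1)) ^+ 2 * (n + 2) =
    - 2 * (c / (n + 1) * c) + (c / (n + 1)) ^+ 2 * n by field.
  by lra.
rewrite mulNr oppr_ge0 pmulr_lle0; last by lra.
rewrite real_exprn_even_le0 ?num_real//= mulf_eq0 invr_eq0 (negbTE n1) orbF.
by move/eqP.
Qed.

(** Membership holds even for the default value 0 of the choice, since a
    subspace contains 0. *)
Lemma orth_proj_mem (U : set X) (x : X) :
  GRing.submod_closed [in U] -> U (orth_proj dot U x).
Proof.
by move=> subU; rewrite /orth_proj; case: xgetP => [p _ []//|_]; exact: subspace0.
Qed.

Lemma orth_proj_orthogonal (U : set X) (x : X) :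
  closed_linear_subspace U ->
  forall u, U u -> dot (x - orth_proj dot U x) u = 0.
Proof.
move=> clU; have [p Up pmin] := minimizer_exists x clU.
suff [] : [set p | U p /\ forall u, U u -> dot (x - p) u = 0]
    (orth_proj dot U x) by [].
by apply: xgetPex; exists p; split=> //; exact: minimizer_orthogonal clU.1 Up pmin.
Qed.

(** Two candidates differ by a vector of [U] that is orthogonal to [U], hence to
    itself. *)
Lemma orth_proj_unique (U : set X) (x : X) p :
  closed_linear_subspace U -> U p ->
  (forall u, U u -> dot (x - p) u = 0) -> orth_proj dot U x = p.
Proof.
move=> clU Up orthp; have subU := clU.1.
have Uq := orth_proj_mem x subU; have orthq := orth_proj_orthogonal x clU.
apply/eqP; rewrite -subr_eq0; apply/eqP; apply: dot_definite.
have Ud := subspaceB subU Uq Up.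
have {1}-> : orth_proj dot U x - p = (x - p) - (x - orth_proj dot U x).
  by rewrite opprB [RHS]addrC addrA subrK.
by rewrite linearBl /= orthp// orthq// subrr.
Qed.

(** [a *: P x + P y] meets the two conditions that characterise the projection
    of [a *: x + y]. *)
Lemma orth_proj_linear (U : set X) :
  closed_linear_subspace U -> linear (orth_proj dot U).
Proof.
move=> clU a x y; have [_ Ulin] := subspace_zero_lin clU.1.
apply: orth_proj_unique => //; first by apply: Ulin; exact: orth_proj_mem _ clU.1.
move=> u Uu; rewrite opprD addrACA -scalerBr linearPl /=.
by rewrite !orth_proj_orthogonal// mulr0 addr0.
Qed.

(** * Products of three reflectors *)

Lemma orth_reflectorE (U : set X) (x : X) :
  orth_reflector dot U x = 2 *: orth_proj dot U x - x.
Proof. by []. Qed.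

(** Keeping the points [v] and [w] unexpanded makes this a telescoping sum. *)
Lemma reflector3E (U V W : set X) x :
  let v := orth_reflector dot U x in
  let w := orth_reflector dot V v in
  orth_reflector dot W w =
  2 *: (orth_proj dot U x - orth_proj dot V v + orth_proj dot W w) - x.
Proof.
move=> v w.
have wE : w = 2 *: (orth_proj dot V v - orth_proj dot U x) + x.
  rewrite /w orth_reflectorE {2}/v orth_reflectorE opprB.
  by rewrite scalerBr addrA addrAC.
rewrite orth_reflectorE {2}wE opprD addrA; congr (_ - x).
by rewrite -scalerN opprB -scalerDr addrC.
Qed.

Lemma reflector3_fixedP (U V W : set X) x :
  let v := orth_reflector dot U x in
  let w := orth_reflector dot V v in
  orth_reflector dot W w = x <->
  orth_proj dot U x - orth_proj dot V v + orth_proj dot W w = x.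
Proof.
move=> v w; rewrite reflector3E; set t := _ + orth_proj dot W w.
split=> [/eqP|->]; last by rewrite scaler_nat mulr2n addrK.
have two_neq0 : (2 : R) != 0 by rewrite pnatr_eq0.
by rewrite subr_eq -mulr2n -[x *+ 2]scaler_nat => /eqP /(scalerI two_neq0).
Qed.

(** Linearity is applied to [P_V] at [v = 2 P_U x - x] and to [P_W] at
    [w = 2 P_V v - v]. *)
Lemma reflector3_projE (U V W : set X) x :
  closed_linear_subspace V -> closed_linear_subspace W ->
  let v := orth_reflector dot U x in
  let w := orth_reflector dot V v in
  orth_proj dot U x - orth_proj dot V v + orth_proj dot W w =
  (4 *: (orth_proj dot W \o orth_proj dot V \o orth_proj dot U)
       - 2 *: ((orth_proj dot W \o orth_proj dot V) + (orth_proj dot W \o orth_proj dot U)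
               + (orth_proj dot V \o orth_proj dot U))
       + orth_proj dot W + orth_proj dot V + orth_proj dot U) x.
Proof.
move=> clV clW v w.
have projR (S : set X) (clS : closed_linear_subspace S) y z :
    orth_proj dot S (2 *: y - z) = 2 *: orth_proj dot S y - orth_proj dot S z.
  have lin := orth_proj_linear clS.
  by rewrite (zmod_morphism_linear lin) (scalable_linear lin).
rewrite /w orth_reflectorE projR // /v orth_reflectorE !projR //.
rewrite !fctE /= !scalerBr !scalerA -natrM opprB opprB !scalerDr !opprD !addrA.
(* both sides are now sums of the same seven terms, in a different order *)
by rewrite [LHS](ACl (4*5*7*3*6*2*1)).
Qed.

End InnerProduct.

Theorem theorem2p7 (R : realType) (X : completeNormedModType R)
    (dot : {dot X for idfun}) (hdot : inner_product_norm dot)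
    (U V W : set X)
    (hU : closed_linear_subspace U)
    (hV : closed_linear_subspace V)
    (hW : closed_linear_subspace W) :
  fixed_points (orth_reflector dot W \o orth_reflector dot V \o orth_reflector dot U) =
  fixed_points (4 *: (orth_proj dot W \o orth_proj dot V \o orth_proj dot U)
       - 2 *: ((orth_proj dot W \o orth_proj dot V) + (orth_proj dot W \o orth_proj dot U)
               + (orth_proj dot V \o orth_proj dot U))
       + orth_proj dot W + orth_proj dot V + orth_proj dot U)
  /\
  fixed_points (orth_reflector dot W \o orth_reflector dot V \o orth_reflector dot U)
    `<=` set_add (set_add U V) W.
Proof.
split; last first.
  move=> x /reflector3_fixedP /= <-.
  exists (orth_proj dot U x - orth_proj dot V (orth_reflector dot U x)).
    exists (orth_proj dot U x); first exact: orth_proj_mem _ hU.1.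
    exists (- orth_proj dot V (orth_reflector dot U x)) => //.
    by apply: subspaceN hV.1 _; exact: orth_proj_mem _ hV.1.
  by exists (orth_proj dot W (orth_reflector dot V (orth_reflector dot U x)));
    first exact: orth_proj_mem _ hW.1.
rewrite predeqE => x; rewrite /fixed_points /=.
rewrite -(reflector3_projE hdot)//.
exact: reflector3_fixedP.
Qed.
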